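(* Let $H$ be a connected $k$-uniform hypergraph. Then for any eigenvalue $\lambda$ of the adjacency tensor $\mathcal{A}(H)$ with $|\lambda|=\rho(\mathcal{A}(H))$, each point $p\in\mathbb{V}_\lambda(\mathcal{A}(H))$ has local intersection multiplicity $1$.
   Context: Tensors. A tensor $\mathcal{A}=(a_{i_1\ldots i_k})$ of order $k\ge 2$ and dimension $n$ is an array of entries $a_{i_1\ldots i_k}\in\mathbb{C}$, $i_1,\ldots,i_k\in[n]=\{1,\ldots,n\}$. For $x\in\mathbb{C}^n$, $(\mathcal{A}x^{k-1})_i=\sum_{i_2,\ldots,i_k\in[n]}a_{ii_2\ldots i_k}x_{i_2}\cdots x_{i_k}$, and $x^{[k-1]}=(x_1^{k-1},\ldots,x_n^{k-1})$. A number $\lambda\in\mathbb{C}$ is an eigenvalue of $\mathcal{A}$ if $\mathcal{A}x^{k-1}=\lambda x^{[k-1]}$ for some $x\in\mathbb{C}^n\setminus\{0\}$. The spectral radius $\rho(\mathcal{A})$ is the largest modulus of the eigenvalues of $\mathcal{A}$. The projective eigenvariety is $\mathbb{V}_\lambda(\mathcal{A})=\{x\in\mathbb{P}^{n-1}:\mathcal{A}x^{k-1}=\lambda x^{[k-1]}\}$, with $\mathbb{P}^{n-1}$ complex projective space. Hypergraphs. A hypergraph $H$ consists of a finite vertex set $V(H)$ and a set $E(H)$ of subsets of $V(H)$ (edges); it is $k$-uniform if every edge has exactly $k$ elements. For a $k$-uniform $H$ on vertices $v_1,\ldots,v_n$, the adjacency tensor $\mathcal{A}(H)$ has order $k$ and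 dimension $n$, with entry $a_{i_1\ldots i_k}=\frac{1}{(k-1)!}$ if $\{v_{i_1},\ldots,v_{i_k}\}\in E(H)$ and $0$ otherwise. Local intersection multiplicity. The local intersection multiplicity of an isolated point $p\in\mathbb{V}_\lambda(\mathcal{A})$ is taken with respect to the homogeneous ideal generated by $F_i=\lambda x_i^{k-1}-(\mathcal{A}x^{k-1})_i$, $i\in[n]$, and is computed on any affine chart containing $p$: if $p_j\ne 0$, normalize $p_j=1$, let $f_i$ be obtained from $F_i$ by setting $x_j=1$, let $\tilde p\in\mathbb{C}^{n-1}$ be $p$ with the $j$-th coordinate removed, let $S=\mathbb{C}[x_i: i\in[n]\setminus\{j\}]$ and let $M_{\tilde p}$ be the maximal ideal of $S$ corresponding to $\tilde p$; then the multiplicity is $\dim_{\mathbb{C}} S_{M_{\tilde p}}/\langle f_1,\ldots,f_n\rangle S_{M_{\tilde p}}$. It does not depend on the chart. For $\mathcal{A}(H)$ and $\lambda$ as in the statement, $\mathbb{V}_\lambda(\mathcal{A}(H))$ is known to be finite, so all of its points are isolated. *)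

(* Defs.v *)
From HB Require Import structures.
From mathcomp Require Import all_boot all_order all_algebra.
From mathcomp Require Import fraction mpoly complex reals.

Set Implicit Arguments.
Unset Strict Implicit.
Unset Printing Implicit Defensive.

Import Order.TTheory GRing.Theory Num.Theory.

Local Open Scope ring_scope.

(* An order-k, n-dimensional tensor; the entry a_{i i_2 ... i_k} is
   [A i [tuple i_2; ...; i_k]]. The first index is kept apart because
   A x^{k-1} contracts only the k - 1 others. Meaningful for k >= 1. *)
Definition tensor (C : Type) (k n : nat) : Type :=
  'I_n -> k.-1.-tuple 'I_n -> C.

Definition tensor_apply (C : comNzRingType) (k n : nat) (A : tensor C k n)
    (x : 'rV[C]_n) : 'rV[C]_n :=
  \row_i \sum_(t : k.-1.-tuple 'I_n) A i t * \prod_(s <- t) x 0 s.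

Definition hadamard_pow (C : comNzRingType) (n m : nat) (x : 'rV[C]_n) :
    'rV[C]_n :=
  map_mx (fun a => a ^+ m) x.

(* Points of P^{n-1} are given by homogeneous coordinates: [x] satisfies this
   predicate iff x is nonzero and its class lies in V_lam(A). *)
Definition in_eigenvariety (C : comNzRingType) (k n : nat) (A : tensor C k n)
    (lam : C) (x : 'rV[C]_n) : Prop :=
  x != 0 /\ tensor_apply A x = lam *: hadamard_pow k.-1 x.

Definition is_eigenvalue (C : comNzRingType) (k n : nat) (A : tensor C k n)
    (lam : C) : Prop :=
  exists x : 'rV[C]_n, in_eigenvariety A lam x.

Definition is_spectral_radius (C : numClosedFieldType) (k n : nat)
    (A : tensor C k n) (rho : C) : Prop :=
  (exists2 lam, is_eigenvalue A lam & `|lam| = rho) /\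
  (forall mu, is_eigenvalue A mu -> `|mu| <= rho).

Definition hypergraph (V : finType) : Type := {set {set V}}.

Definition hypergraph_uniform (V : finType) (k : nat) (E : hypergraph V) : Prop :=
  forall e, e \in E -> #|e| = k.

Definition hypergraph_adjacent (V : finType) (E : hypergraph V) : rel V :=
  fun u w => [exists e in E, (u \in e) && (w \in e)].

Definition hypergraph_connected (V : finType) (E : hypergraph V) : Prop :=
  forall u w : V, connect (hypergraph_adjacent E) u w.

(* [v] is the labelling v_1, ..., v_n of the vertices. *)
Definition adjacency_tensor (C : fieldType) (k n : nat) (V : finType)
    (v : 'I_n -> V) (E : hypergraph V) : tensor C k n :=
  fun i t => if [set v a | a in i :: t] \in E then (k.-1)`!%:R^-1 else 0.
Arguments adjacency_tensor C k {n V} v E.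

Definition eigen_poly (C : comNzRingType) (k n : nat) (A : tensor C k n)
    (lam : C) (i : 'I_n) : {mpoly C[n]} :=
  lam *: 'X_i ^+ k.-1
  - \sum_(t : k.-1.-tuple 'I_n) A i t *: \prod_(s <- t) 'X_s.

(* Setting x_j = 1; the variables other than x_j are indexed by 'I_n.-1
   through [lift j]. *)
Definition dehomogenize (C : comNzRingType) (n : nat) (j : 'I_n)
    (F : {mpoly C[n]}) : {mpoly C[n.-1]} :=
  F \mPo [tuple if unlift j i is Some i' then 'X_i' else 1 | i < n].

Definition chart_point (C : fieldType) (n : nat) (j : 'I_n) (x : 'rV[C]_n) :
    'I_n.-1 -> C :=
  fun i => x 0 (lift j i) / x 0 j.

(* The localization S_M of S = C[x_1, ..., x_m] at the maximal ideal
   M = {h | h(q) = 0}, as a subring of the fraction field of S. *)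
Definition in_local_ring (C : fieldType) (m : nat) (q : 'I_m -> C)
    (z : {fraction {mpoly C[m]}}) : Prop :=
  exists g h : {mpoly C[m]}, h.@[q] != 0 /\ z = tofrac g / tofrac h.

Definition in_local_ideal (C : fieldType) (m n : nat) (q : 'I_m -> C)
    (f : 'I_n -> {mpoly C[m]}) (z : {fraction {mpoly C[m]}}) : Prop :=
  exists c : 'I_n -> {fraction {mpoly C[m]}},
    (forall i, in_local_ring q (c i)) /\ z = \sum_i c i * tofrac (f i).

(* dim_C (S_M / <f_1, ..., f_n> S_M) = d: there are d elements of S_M whose
   classes form a basis of the quotient over C. *)
Definition local_quotient_dim (C : fieldType) (m n : nat) (q : 'I_m -> C)
    (f : 'I_n -> {mpoly C[m]}) (d : nat) : Prop :=
  exists2 b : 'I_d -> {fraction {mpoly C[m]}},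
    forall i, in_local_ring q (b i) &
    forall z, in_local_ring q z ->
      exists! c : 'rV[C]_d,
        in_local_ideal q f (z - \sum_i tofrac ((c 0 i)%:MP) * b i).

(* The local intersection multiplicity at the point with homogeneous
   coordinates [x], computed in the chart x_j <> 0, equals d. *)
Definition local_multiplicity (C : fieldType) (k n : nat) (A : tensor C k n)
    (lam : C) (x : 'rV[C]_n) (j : 'I_n) (d : nat) : Prop :=
  local_quotient_dim (chart_point j x)
    (fun i => dehomogenize j (eigen_poly A lam i)) d.

(* Main.v *)
(* Let [y] be the vector of moduli of [p]. Since [A] is symmetric and
   nonnegative, the maximum of [k * sum_e y^e] over [y >= 0] with
   [sum_i y_i^k = 1] is an eigenvalue, so it is at most [rho]; summing the
   triangle inequalities [rho * y_i^k <= sum_(e ni i) y^e] over [i] then shows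
   that [y] is itself a maximizer and that all these inequalities are
   equalities. Connectedness makes the maximizer positive, and for every [i]
   all the [p^e] with [i] in [e] have the same phase. Writing a vector in the
   kernel of the Jacobian at [p] as [p * w], the phases cancel and the kernel
   equations become [sum_(e ni i) y^e sum_(s in e) (w_i - w_s) = 0], i.e. [w] is
   harmonic for a positive symmetric weight on a connected graph, hence
   constant. So the Jacobian in the chart has full column rank, and by Cramer's
   rule the local ideal is the maximal ideal. *)
Require Import Defs.
From mathcomp Require Import all_boot all_order all_algebra.
From mathcomp Require Import complex reals.
From mathcomp Require Import ring lra.
From mathcomp Require all_classical topology normedtype exp derive realfun.
From mathcomp Require fraction mpoly.

Set Implicit Arguments.
Unset Strict Implicit.
Unset Printing Implicit Defensive.

Import Order.TTheory GRing.Theory Num.Theory.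

Local Open Scope ring_scope.
Local Open Scope complex_scope.

(** * Edge forms and connectedness *)

Definition edge_sum (R : comPzSemiRingType) (T : finType) (E : hypergraph T)
    (y : T -> R) : R :=
  \sum_(e in E) \prod_(s in e) y s.

(** For the adjacency tensor A this is y_i (A y^{k-1})_i. The extra factor y_i keeps the monomials
    of whole edges, and the eigenvalue equation reads [star_sum E y i = lam * y i ^+ k]. *)
Definition star_sum (R : comPzSemiRingType) (T : finType) (E : hypergraph T)
    (y : T -> R) (i : T) : R :=
  \sum_(e in E | i \in e) \prod_(s in e) y s.

Section Hypergraph.

Variables (T : finType) (k : nat) (E : hypergraph T).
Hypotheses (Eunif : hypergraph_uniform k E) (Econn : hypergraph_connected E).

(** Each edge is counted once for each of its [k] vertices. *)
Lemma sum_star_sum (R : comPzSemiRingType) (y : T -> R) :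
  \sum_i star_sum E y i = k%:R * edge_sum E y.
Proof.
rewrite /star_sum /edge_sum (exchange_big_dep [in E]) /=; last first.
  by move=> i e _ /andP[].
rewrite big_distrr /=; apply: eq_bigr => e eE.
rewrite (eq_bigl (fun i => i \in e)) => [|i]; last by rewrite eE.
by rewrite sumr_const Eunif // mulr_natl.
Qed.

Lemma connected_const (U : eqType) (f : T -> U) :
    (forall e u w, e \in E -> u \in e -> w \in e -> f u = f w) ->
  forall u w, f u = f w.
Proof.
move=> fE u w; apply/eqP.
have cl : closed (hypergraph_adjacent E) [pred a | f u == f a].
  move=> a b /existsP[e /and3P[eE ae be]].
  by rewrite !inE (fE e a b).
by have := closed_connect cl (Econn u w); rewrite !inE eqxx => <-.
Qed.

End Hypergraph.

(** * Nonnegative maximizers of the edge form *)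

Section Maximizer.

Variables (R : realFieldType) (T : finType) (k : nat) (E : hypergraph T).
Hypotheses (k_gt0 : (0 < k)%N) (Eunif : hypergraph_uniform k E).
Hypothesis Econn : hypergraph_connected E.
Variables (mu : R) (y : T -> R).
Hypothesis mu_ge0 : 0 <= mu.
Hypothesis mu_max : forall z : T -> R, (forall i, 0 <= z i) ->
  k%:R * edge_sum E z <= mu * \sum_i z i ^+ k.
Hypothesis y_ge0 : forall i, 0 <= y i.
Hypothesis y_max : k%:R * edge_sum E y = mu * \sum_i y i ^+ k.

(* If [y] vanishes somewhere, raising its zero entries to [eps] gains at least
   order [eps ^ (k - 1)] on an edge meeting both the zero set and the support,
   but costs only order [eps ^ k]. *)
Lemma maximizer_gt0 j : y j != 0 -> forall i, 0 < y i.
Proof.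
move=> yj i; rewrite lt_def y_ge0 andbT; apply/negP => /eqP yi.
(* Some edge contains a zero [a] of [y] and a point [b] of its support: otherwise vanishing would be
   constant along edges, hence everywhere by connectedness. *)
have /exists_inP[e eE /exists_inP[a ae /exists_inP[b be /andP[/eqP ya yb]]]] :
    [exists e in E, [exists a in e, [exists b in e, (y a == 0) && (y b != 0)]]].
  apply: contraT; rewrite negb_exists_in => /forall_inP noE.
  have /(connected_const Econn) /(_ i j) : forall e u w,
      e \in E -> u \in e -> w \in e -> (y u == 0) = (y w == 0).
    have imp e u w : e \in E -> u \in e -> w \in e -> y u == 0 -> y w == 0.
      move=> eE ue we yu; apply: contraT => yw.
      have /negP[] := noE e eE; apply/exists_inP.
      by exists u => //; apply/exists_inP; exists w => //; rewrite yu.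
    by move=> e u w eE ue we; apply/idP/idP; apply: (imp e).
  by rewrite yi eqxx (negPf yj).
have yb0 : 0 < y b by rewrite lt_def yb y_ge0.
(* The first bound makes the cost [mu * #|T| * eps ^ k] smaller than the gain
   [k * y b * eps ^ (k - 1)]; the second makes every entry of the modified vector at least [eps]. *)
have [eps [eps0 eps_small eps_y]] : exists eps : R, [/\ 0 < eps,
    mu * #|T|%:R * eps < k%:R * y b & forall s, y s != 0 -> eps <= y s].
  pose d := \big[Order.min/1]_(s | y s != 0) y s.
  have d0 : 0 < d.
    by apply: lt_bigmin => // s ys; rewrite lt_def ys y_ge0.
  have c0 : 0 < k%:R * y b by rewrite mulr_gt0 // ltr0n.
  have m0 : 0 <= mu * #|T|%:R by rewrite mulr_ge0.
  set c := k%:R * y b in c0 *; set m := mu * _ in m0 *.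
  (* Dividing by [m + 1] also covers [m = 0]. *)
  have m1 : 0 < m + 1 by lra.
  exists (Order.min d (c / (m + 1))); split.
  - by rewrite lt_min d0 divr_gt0.
  - apply: (le_lt_trans (y := m * (c / (m + 1)))).
      by rewrite ler_wpM2l // ge_min lexx orbT.
    by rewrite mulrA ltr_pdivrMr // mulrC ltr_pM2l //; lra.
  - by move=> s ys; rewrite ge_min bigmin_le_cond.
pose z s := if y s == 0 then eps else y s.
have z_eps s : eps <= z s by rewrite /z; case: eqVneq => // /eps_y.
have z_y s : y s <= z s by rewrite /z; case: eqVneq => // ->; apply: ltW.
have z0 s : 0 <= z s by apply: le_trans (z_y s).
have zk : \sum_s z s ^+ k <= \sum_s y s ^+ k + #|T|%:R * eps ^+ k.
  rewrite mulr_natl -sumr_const -big_split /=; apply: ler_sum => s _.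
  rewrite /z; case: eqVneq => [->|_]; first by rewrite expr0n gtn_eqF ?add0r.
  by rewrite lerDl exprn_ge0 // ltW.
(* The edge [e] contributes 0 to the form at [y], because [y a = 0], and at least
   [y b * eps ^ (k - 1)] at [z]; no other edge loses. *)
have zE : edge_sum E y + y b * eps ^+ k.-1 <= edge_sum E z.
  rewrite /edge_sum (bigD1 e) //= [in leRHS](bigD1 e) //= addrAC.
  apply: lerD; last first.
    by apply: ler_sum => f _; apply: ler_prod => s _; rewrite y_ge0 z_y.
  rewrite (bigD1 a) //= ya mul0r add0r (bigD1 b) //=.
  apply: ler_pM; [exact: y_ge0|by rewrite exprn_ge0 // ltW|exact: z_y|].
  have -> : eps ^+ k.-1 = \prod_(s in e :\ b) eps.
    by rewrite prodr_const -(Eunif eE) (cardsD1 b e) be.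
  rewrite [leLHS](eq_bigl (fun s => (s \in e) && (s != b))); last first.
    by move=> s; rewrite !inE andbC.
  by apply: ler_prod => s _; rewrite z_eps ltW.
have := mu_max z0; apply/negP; rewrite -ltNge.
apply: (le_lt_trans (y := mu * (\sum_s y s ^+ k + #|T|%:R * eps ^+ k))).
  exact: ler_wpM2l.
apply: (lt_le_trans (y := k%:R * (edge_sum E y + y b * eps ^+ k.-1))); last first.
  by apply: ler_wpM2l.
rewrite !mulrDr y_max ltrD2l -[X in _ ^+ X](prednK k_gt0) exprS !mulrA.
by rewrite ltr_pM2r // exprn_gt0.
Qed.

(** A second-order upper bound that takes the place of differentiation in the stationarity
    argument. *)
Lemma expr1D_bound m : exists2 D : R, 0 <= D &
  forall s, `|s| <= 1 -> (1 + s) ^+ m <= 1 + m%:R * s + D * s ^+ 2.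
Proof.
elim: m => [|m [D D0 IH]].
  by exists 0 => // s _; rewrite expr0 mul0r mul0r !addr0.
(* The old remainder is multiplied by [1 + s <= 2], and [s * (m * s)] adds [m]. *)
exists (2 * D + m%:R) => [|s s1]; first by rewrite addr_ge0 // mulr_ge0.
move: (IH s s1) (s1); rewrite (exprS (1 + s)) ler_norml => IHs /andP[sl sr].
have m0 : 0 <= m%:R :> R by [].
apply: (le_trans (y := (1 + s) * (1 + m%:R * s + D * s ^+ 2))).
  by apply: ler_wpM2l => //; lra.
rewrite -subr_ge0 -natr1.
have -> : 1 + (m%:R + 1) * s + (2 * D + m%:R) * s ^+ 2
  - (1 + s) * (1 + m%:R * s + D * s ^+ 2) = D * s ^+ 2 * (1 - s) by ring.
by apply: mulr_ge0; [rewrite mulr_ge0 ?sqr_ge0 | rewrite subr_ge0].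
Qed.

(* Stationarity under rescaling the entry [i] by [1 + s]. *)
Lemma maximizer_eigen i : star_sum E y i = mu * y i ^+ k.
Proof.
set a := star_sum E y i; set b := mu * y i ^+ k.
have b0 : 0 <= b by rewrite mulr_ge0 // exprn_ge0.
have [D D0 expD] := expr1D_bound k.
(* This holds for [s] of both signs, so the linear coefficient [a - b] must vanish. *)
have ineq s : `|s| <= 1 -> k%:R * s * (a - b) <= b * D * s ^+ 2.
  move=> s1; have := s1; rewrite ler_norml => /andP[sl sr].
  have s0 : 0 <= 1 + s by lra.
  pose z l := y l * (if l == i then 1 + s else 1).
  have z0 l : 0 <= z l by rewrite mulr_ge0 //; case: eqP.
  have zE : edge_sum E z = edge_sum E y + s * a.
    rewrite /edge_sum [in LHS](bigID (fun e : {set T} => i \in e)) /=.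
    rewrite [in RHS](bigID (fun e : {set T} => i \in e)) /= addrAC; congr (_ + _).
      rewrite -/(star_sum E y i) -/a -[X in X + _]mul1r -mulrDl.
      rewrite /a /star_sum mulr_sumr; apply: eq_bigr => e /andP[_ ie].
      rewrite /z big_split /= mulrC; congr (_ * _).
      by rewrite -big_mkcondr (big_pred1 i) // => l /=; have [->|] := eqVneq l i; rewrite ?ie ?andbF.
    apply: eq_bigr => e /andP[_ ie]; apply: eq_bigr => l le.
    by rewrite /z; case: eqP => [li|]; [rewrite li (negPf ie) in le|rewrite mulr1].
  have zk : mu * \sum_l z l ^+ k = mu * \sum_l y l ^+ k + b * ((1 + s) ^+ k - 1).
    rewrite (bigD1 i) //= [in RHS](bigD1 i) //= /z eqxx exprMn.
    rewrite (eq_bigr (fun l => y l ^+ k)) => [|l /negPf ->]; last by rewrite mulr1.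
    by rewrite /b; ring.
  have := mu_max z0; rewrite zE zk mulrDr y_max lerD2l => le1.
  have le2 : b * ((1 + s) ^+ k - 1) <= b * (k%:R * s + D * s ^+ 2).
    by apply: ler_wpM2l => //; have := expD s s1; lra.
  by have := le_trans le1 le2; rewrite mulrDr; lra.
apply/eqP; rewrite -subr_eq0; apply/negP => /negP ab.
(* The test value is [s = (a - b) / M]: [M >= |a - b|] keeps [|s| <= 1], and [M > b * D] makes the
   linear term, equal to [k * M * s ^ 2], exceed the quadratic bound. *)
pose M := b * D + `|a - b| + 1.
have bD : 0 <= b * D by rewrite mulr_ge0.
have M0 : 0 < M by rewrite /M; have := normr_ge0 (a - b); lra.
have /ineq : `|(a - b) / M| <= 1.
  by rewrite normrM normfV [`|M|]gtr0_norm // ler_pdivrMr // mul1r /M; lra.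
apply/negP; rewrite -ltNge.
have -> : k%:R * ((a - b) / M) * (a - b) = ((a - b) / M) ^+ 2 * (k%:R * M).
  by field; rewrite gt_eqF.
rewrite mulrC ltr_pM2l; last by rewrite exprn_even_gt0 //= mulf_neq0 // invr_eq0 gt_eqF.
have k1 : 1 <= k%:R :> R by rewrite ler1n.
apply: (lt_le_trans (y := 1 * M)); last by rewrite ler_wpM2r // ltW.
by rewrite mul1r /M; have := normr_ge0 (a - b); lra.
Qed.

End Maximizer.

Lemma edge_sumZ (R : comPzSemiRingType) (T : finType) (k : nat)
    (E : hypergraph T) (c : R) (y : T -> R) : hypergraph_uniform k E ->
  edge_sum E (fun i => c * y i) = c ^+ k * edge_sum E y.
Proof.
move=> Eunif; rewrite /edge_sum mulr_sumr; apply: eq_bigr => e eE.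
by rewrite big_split prodr_const /= Eunif.
Qed.

(** * Existence of a maximizer *)

Section Compactness.
Import all_classical topology normedtype exp derive realfun.
Import numFieldNormedType.Exports.
Local Open Scope classical_set_scope.

Variables (R : realType) (n k : nat) (E : hypergraph 'I_n) (i0 : 'I_n).
Hypotheses (k_gt0 : (0 < k)%N) (Eunif : hypergraph_uniform k E).

(** The form attains its maximum on the compact set of nonnegative vectors with k-th powers summing
    to 1, and [mu] is [k] times this maximum. Both sides of the bound are homogeneous of degree [k],
    so rescaling extends it to all nonnegative vectors. *)
Lemma exists_maximizer : exists (mu : R) (y : 'I_n -> R),
  [/\ 0 <= mu,
      forall z : 'I_n -> R, (forall i, 0 <= z i) ->
        k%:R * edge_sum E z <= mu * \sum_i z i ^+ k,
      forall i, 0 <= y i,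
      k%:R * edge_sum E y = mu * \sum_i y i ^+ k &
      exists j, y j != 0].
Proof.
have coord_cont i : continuous (fun x : 'rV[R]_n => x 0 i).
  by apply: coord_continuous.
pose I : set R := `[0, 1].
(* The box supplies compactness; its upper bound excludes no nonnegative vector satisfying the
   normalization. *)
pose K := [set x : 'rV[R]_n | forall i, I (x ord0 i)] `&`
          (fun x => \sum_i x 0 i ^+ k) @^-1` [set 1].
have compactK : compact K.
  apply: compact_closedI.
    by apply: (@rV_compact _ n (fun=> I)) => i; apply: segment_compact.
  apply: preimage_closed; last exact: closed_eq.
  move=> x _; apply: continuous_big => [|i _ y]; first exact: add_continuous.
  apply: (@continuous_comp _ _ _ (fun x : 'rV[R]_n => x 0 i) (fun a => a ^+ k)).
    exact: coord_cont.
  exact: exprn_continuous.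
have cont : continuous (fun x : 'rV[R]_n => edge_sum E (x 0)).
  apply: continuous_big => [|e _]; first exact: add_continuous.
  apply: continuous_big => [|e' _]; first exact: mul_continuous.
  exact: coord_cont.
have K0 : K !=set0.
  exists (delta_mx 0 i0); split => [i|] /=.
    by rewrite /I /= in_itv /= mxE eqxx; case: (i == i0); rewrite /= ?lexx ?ler01.
  rewrite (bigD1 i0) //= big1 ?mxE ?eqxx ?expr1n ?addr0 // => i ii0.
  by rewrite mxE (negPf ii0) expr0n gtn_eqF.
have [c /set_mem[cI /= cS] cmax] :=
  compact_EVT_max K0 compactK (continuous_subspaceT cont).
have c0 i : 0 <= c 0 i by have := cI i; rewrite /I /= in_itv => /andP[].
have ec0 : 0 <= edge_sum E (c 0).
  by apply: sumr_ge0 => e _; apply: prodr_ge0.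
exists (k%:R * edge_sum E (c 0)), (c 0); split=> //.
- by rewrite mulr_ge0.
- move=> z z0; rewrite -mulrA ler_wpM2l //.
  set S := \sum_i z i ^+ k.
  have zk0 i : 0 <= z i ^+ k by rewrite exprn_ge0.
  have S0 : 0 <= S by apply: sumr_ge0.
  (* When [S = 0] there is nothing to normalize: [z] is zero, and every edge product vanishes
     because edges are nonempty. *)
  have [SE|Sn0] := eqVneq S 0.
    have zE i : z i = 0.
      move/eqP: SE; rewrite psumr_eq0 // => /allP /(_ i).
      by rewrite mem_index_enum expf_eq0 k_gt0 => /(_ isT) /eqP.
    rewrite SE mulr0 /edge_sum big1 // => e /Eunif ek.
    have /card_gt0P[s se] : (0 < #|e|)%N by rewrite ek.
    by rewrite (bigD1 s) //= zE mul0r.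
  have Sp : 0 < S by rewrite lt_def Sn0.
  pose r := S `^ k%:R^-1.
  have rp : 0 < r by apply: powR_gt0.
  have rk : r ^+ k = S.
    rewrite -powR_mulrn ?ltW // -powRrM mulVf ?powRr1 //.
    by rewrite pnatr_eq0 -lt0n.
  pose x : 'rV[R]_n := \row_i (r^-1 * z i).
  have xS : \sum_i x 0 i ^+ k = 1.
    under eq_bigr do rewrite mxE exprMn exprVn rk.
    by rewrite -mulr_sumr mulVf.
  have x0 i : 0 <= x 0 i by rewrite mxE mulr_ge0 // invr_ge0 ltW.
  have xK : x \in K.
    rewrite inE; split => //= i; rewrite /I /= in_itv /= x0 /=.
    rewrite -(@expr_le1 _ k) //; rewrite -xS (bigD1 i) //= lerDl.
    by apply: sumr_ge0 => j _; rewrite exprn_ge0.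
  have := cmax x xK.
  have -> : edge_sum E (x 0) = edge_sum E (fun i => r^-1 * z i).
    by apply: eq_bigr => e _; apply: eq_bigr => i _; rewrite mxE.
  by rewrite (edge_sumZ _ _ Eunif) exprVn rk ler_pdivrMl // mulrC.
- by rewrite cS mulr1.
- apply: contrapT => /forallNP c00; move/eqP: cS.
  rewrite big1 => [|i _]; first by rewrite eq_sym oner_eq0.
  have := c00 i; case: eqP => // -> _.
  by rewrite expr0n gtn_eqF.
Qed.

End Compactness.

(** The eigenvalue equation will give [mu <= rho]; the bound in the last clause is kept for
    comparison with the moduli of an arbitrary extremal eigenvector. *)
Lemma perron (R : realType) (n k : nat) (E : hypergraph 'I_n) :
    (0 < n)%N -> (0 < k)%N -> hypergraph_uniform k E ->
    hypergraph_connected E ->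
  exists (mu : R) (y : 'I_n -> R),
    [/\ 0 <= mu, forall i, 0 < y i,
        forall i, star_sum E y i = mu * y i ^+ k &
        forall z : 'I_n -> R, (forall i, 0 <= z i) ->
          k%:R * edge_sum E z <= mu * \sum_i z i ^+ k].
Proof.
move=> n0 k0 Eu Ec.
have [mu [y [mu0 mumax y0 ymax [j yj]]]] := exists_maximizer R (Ordinal n0) k0 Eu.
exists mu, y; split => //; first exact: (maximizer_gt0 k0 Eu Ec mu0 mumax y0 ymax yj).
by move=> i; apply: (maximizer_eigen k0 mu0 mumax y0 ymax).
Qed.

(** * Jacobians, local rings and multiplicity one *)

Section LocalAlgebra.
Import mpoly fraction.

Lemma mderivXU (C : nzRingType) (n : nat) (i l : 'I_n) :
  ('X_i : {mpoly C[n]})^`M(l) = (i == l)%:R.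
Proof.
rewrite mderivX mnm1E; case: eqVneq => [->|_]; last by rewrite scale0r.
have -> : (U_(l) - U_(l))%MM = 0%MM :> 'X_{1..n}.
  by apply/mnmP => s; rewrite mnmBE subnn mnm0E.
by rewrite mpolyX0 scale1r.
Qed.

Definition dir_deriv (C : comNzRingType) (n : nat) (p z : 'I_n -> C)
    (F : {mpoly C[n]}) : C :=
  \sum_i (F^`M(i)).@[p] * z i.

Section DirectionalDerivative.
Variables (C : comNzRingType) (n : nat) (p : 'I_n -> C).

Lemma dir_derivB z (F G : {mpoly C[n]}) :
  dir_deriv p z (F - G) = dir_deriv p z F - dir_deriv p z G.
Proof.
by rewrite /dir_deriv -sumrB; apply: eq_bigr => i _; rewrite mderivB mevalB mulrBl.
Qed.

Lemma dir_derivZ z c (F : {mpoly C[n]}) :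
  dir_deriv p z (c *: F) = c * dir_deriv p z F.
Proof.
by rewrite /dir_deriv mulr_sumr; apply: eq_bigr => i _; rewrite mderivZ mevalZ mulrA.
Qed.

Lemma dir_deriv_sum z (I : Type) (r : seq I) (P : pred I) (F : I -> {mpoly C[n]}) :
  dir_deriv p z (\sum_(s <- r | P s) F s) = \sum_(s <- r | P s) dir_deriv p z (F s).
Proof.
rewrite /dir_deriv exchange_big /=; apply: eq_bigr => i _.
by rewrite (raddf_sum (mderiv i)) raddf_sum mulr_suml.
Qed.

Lemma dir_derivM z (F G : {mpoly C[n]}) :
  dir_deriv p z (F * G) = dir_deriv p z F * G.@[p] + F.@[p] * dir_deriv p z G.
Proof.
rewrite /dir_deriv mulr_suml mulr_sumr -big_split /=; apply: eq_bigr => i _.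
by rewrite mderivM mevalD !mevalM; ring.
Qed.

Lemma dir_derivXU z i : dir_deriv p z 'X_i = z i.
Proof.
rewrite /dir_deriv (bigD1 i) //= big1 => [|j ji].
  by rewrite addr0 mderivXU eqxx meval1 mul1r.
by rewrite mderivXU eq_sym (negPf ji) meval0 mul0r.
Qed.

(* The derivative in direction [p * w] acts on a monomial as a logarithmic
   derivative. *)
Lemma dir_deriv_prodX w (I : Type) (r : seq I) (P : pred I) (f : I -> 'I_n) :
  dir_deriv p (fun i => p i * w i) (\prod_(s <- r | P s) 'X_(f s)) =
  (\prod_(s <- r | P s) p (f s)) * \sum_(s <- r | P s) w (f s).
Proof.
elim: r => [|s r IH].
  rewrite !big_nil mulr0 /dir_deriv big1 // => i _.
  by rewrite -mpolyC1 mderivC meval0 mul0r.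
rewrite !big_cons; case: (P s) => //.
rewrite dir_derivM IH dir_derivXU mevalXU rmorph_prod /=.
under eq_bigr do rewrite mevalXU.
ring.
Qed.

(** The polynomials with such an expansion include constants and variables and are closed under sums
    and products. In particular the maximal ideal at [p] is generated by the [X_i - p_i]. *)
Lemma hadamard_lemma (F : {mpoly C[n]}) : exists a : 'I_n -> {mpoly C[n]},
  F = F.@[p]%:MP + \sum_i a i * ('X_i - (p i)%:MP).
Proof.
pose P (G : {mpoly C[n]}) := exists a : 'I_n -> {mpoly C[n]},
  G = G.@[p]%:MP + \sum_i a i * ('X_i - (p i)%:MP).
have PC c : P c%:MP.
  by exists (fun=> 0); rewrite mevalC big1 ?addr0 // => i _; rewrite mul0r.
have PX i : P 'X_i.
  exists (fun j => (j == i)%:R); rewrite mevalXU (bigD1 i) //= eqxx mul1r.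
  rewrite big1 ?addr0 => [|j /negPf ->]; last by rewrite mul0r.
  by rewrite addrC subrK.
have PD G H : P G -> P H -> P (G + H).
  move=> [a Ga] [b Hb]; exists (fun i => a i + b i).
  rewrite {1}Ga {1}Hb mevalD mpolyCD addrACA; congr (_ + _).
  by rewrite -big_split; apply: eq_bigr => i _; rewrite mulrDl.
have PM G H : P G -> P H -> P (G * H).
  move=> [a Ga] [b Hb]; exists (fun i => a i * H + G.@[p]%:MP * b i).
  set A := \sum_i a i * _ in Ga; set B := \sum_i b i * _ in Hb.
  have -> : \sum_i (a i * H + G.@[p]%:MP * b i) * ('X_i - (p i)%:MP) =
      A * H + G.@[p]%:MP * B.
    by rewrite mulr_suml mulr_sumr -big_split /=; apply: eq_bigr => i _; ring.
  rewrite mevalM mpolyCM.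
  have -> : A = G - G.@[p]%:MP by apply/eqP; rewrite eq_sym subr_eq addrC -Ga.
  have -> : B = H - H.@[p]%:MP by apply/eqP; rewrite eq_sym subr_eq addrC -Hb.
  ring.
elim/mpolyind: F => [|c m G _ _ PG]; first by rewrite -mpolyC0; apply: PC.
apply: (PD) => //; rewrite -mul_mpolyC; apply: (PM) => //.
rewrite mpolyXE_id; apply: (big_ind P) => [| |i _]; first by rewrite -mpolyC1.
  exact: PM.
by elim: (m i) => [|d IH]; rewrite ?expr0 ?exprS -?mpolyC1 //; apply: PM.
Qed.

(** The coefficients [a i] are not unique, but their values at [p] are: in the product rule only the
    term differentiating [X_l - p_l] survives at [p]. *)
Lemma hadamard_coef (F : {mpoly C[n]}) c (a : 'I_n -> {mpoly C[n]}) l :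
  F = c%:MP + \sum_i a i * ('X_i - (p i)%:MP) -> (a l).@[p] = (F^`M(l)).@[p].
Proof.
move=> ->; rewrite mderivD mderivC add0r (raddf_sum (mderiv l)) raddf_sum /=.
have vanish i : ('X_i - (p i)%:MP).@[p] = 0 by rewrite mevalB mevalXU mevalC subrr.
rewrite (bigD1 l) //= big1 => [|i il].
  rewrite addr0 mderivM mevalD !mevalM vanish mulr0 add0r mderivB mderivC subr0.
  by rewrite mderivXU eqxx meval1 mulr1.
rewrite mderivM mevalD !mevalM vanish mulr0 add0r mderivB mderivC subr0.
by rewrite mderivXU (negPf il) meval0 mulr0.
Qed.

End DirectionalDerivative.

Section Fractions.
Variable R : idomainType.
Implicit Types a b c d g h : R.

Lemma tofrac_divD a b a' b' : b != 0 -> b' != 0 ->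
  tofrac a / tofrac b + tofrac a' / tofrac b' =
  tofrac (a * b' + a' * b) / tofrac (b * b').
Proof. by move=> b0 b0'; rewrite addf_div ?tofrac_eq0 // tofracD !tofracM. Qed.

Lemma tofrac_divMr a b c : tofrac a / tofrac b * tofrac c = tofrac (a * c) / tofrac b.
Proof. by rewrite tofracM mulrAC. Qed.

Lemma tofrac_divB_eq g h c a b : h != 0 -> b != 0 ->
  tofrac g / tofrac h - tofrac c = tofrac a / tofrac b -> (g - c * h) * b = a * h.
Proof.
rewrite -(tofrac_eq0 h) -(tofrac_eq0 b) => h0 b0 /eqP.
rewrite -[tofrac c](mulfK h0) -mulrBl eqr_div // -!tofracM -tofracB -tofracM tofrac_eq.
by move/eqP.
Qed.

(** When [u * h] is a unit at the point, this puts the left side in the local ideal. *)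
Lemma tofrac_divB_sum (I : finType) g h d u (c f : I -> R) : h != 0 -> u != 0 ->
  u * (g - d * h) = \sum_i c i * f i ->
  tofrac g / tofrac h - tofrac d = \sum_i tofrac (c i) / tofrac (u * h) * tofrac (f i).
Proof.
rewrite -(tofrac_eq0 h) -(tofrac_eq0 u) => h0 u0 E.
under eq_bigr do rewrite tofrac_divMr.
rewrite -mulr_suml -raddf_sum -E /= !tofracM tofracB tofracM.
by rewrite -mulf_div divff // mul1r mulrBl mulfK.
Qed.

End Fractions.

(** The adjugate avoids inverting [M], whose entries will be polynomials. *)
Lemma cramer_col (R : comNzRingType) (m : nat) (M : 'M[R]_m) (X : 'cV[R]_m) l :
  \det M * X l 0 = \sum_l' \adj M l l' * (M *m X) l' 0.
Proof.
have /colP/(_ l) : (\adj M *m M) *m X = (\det M)%:M *m X by rewrite mul_adj_mx.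
by rewrite -mulmxA mul_scalar_mx mxE [in RHS]mxE => <-.
Qed.

Section LocalRing.
Variables (C : fieldType) (m n : nat) (q : 'I_m -> C).
Variable f : 'I_n -> {mpoly C[m]}.
Hypothesis fq : forall i, (f i).@[q] = 0.

Lemma meval_neq0 (b : {mpoly C[m]}) : b.@[q] != 0 -> b != 0.
Proof. by apply: contraNneq => ->; rewrite meval0. Qed.

(** Since the [f i] vanish at [q], the ideal they generate lies in the maximal ideal. This makes the
    coordinate of a class along 1 unique. *)
Lemma in_local_ideal_vanish z : in_local_ideal q f z ->
  exists a b : {mpoly C[m]},
    [/\ b.@[q] != 0, a.@[q] = 0 & z = tofrac a / tofrac b].
Proof.
move=> [c [cq ->]].
pose P z := exists a b : {mpoly C[m]},
    [/\ b.@[q] != 0, a.@[q] = 0 & z = tofrac a / tofrac b].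
apply: (big_ind P) => [|x y|i _].
- exists 0, 1; split; [|by rewrite meval0|by rewrite tofrac0 mul0r].
  by rewrite meval1 oner_eq0.
- move=> [a [b [bq aq ->]]] [a' [b' [bq' aq' ->]]].
  exists (a * b' + a' * b), (b * b'); split.
  + by rewrite mevalM mulf_neq0.
  + by rewrite mevalD !mevalM aq aq' !mul0r addr0.
  + by rewrite tofrac_divD // meval_neq0.
- have [g [h [hq ->]]] := cq i.
  exists (g * f i), h; split=> //; first by rewrite mevalM fq mulr0.
  exact: tofrac_divMr.
Qed.

(* By Cramer's rule, a left inverse of the Jacobian at [q] expresses each
   [X_l - q_l] through the [f i], up to a factor that is a unit at [q]. *)
Lemma local_quotient_dim1 (g : 'I_n -> 'I_m -> {mpoly C[m]}) :
    (forall i, f i = \sum_l g i l * ('X_l - (q l)%:MP)) ->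
    (forall z : 'I_m -> C,
      (forall i, \sum_l (g i l).@[q] * z l = 0) -> forall l, z l = 0) ->
  local_quotient_dim q f 1.
Proof.
move=> fE ker0.
(* The Jacobian is transposed so that its trivial kernel becomes row freeness. *)
pose J : 'M[C]_(m, n) := \matrix_(l, i) (g i l).@[q].
have /row_freeP[B JB] : row_free J.
  apply: inj_row_free => v vJ; apply/rowP => l; rewrite [RHS]mxE.
  apply: (ker0 (v 0)) => i; have /rowP/(_ i) := vJ; rewrite !mxE => vJi.
  by rewrite -[RHS]vJi; apply: eq_bigr => l' _; rewrite mxE mulrC.
(* [M] sends the column of the [X_l - q_l] to constant combinations of the [f i]. At [q] it is the
   transpose of [J *m B = 1], so its determinant takes the value 1 there. *)
pose M : 'M[{mpoly C[m]}]_m := \matrix_(l, l') \sum_i (B i l)%:MP * g i l'.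
have [h [c [hq cramer]]] : exists (h : {mpoly C[m]}) (c : 'I_m -> 'I_n -> {mpoly C[m]}),
    h.@[q] = 1 /\ forall l, h * ('X_l - (q l)%:MP) = \sum_i c l i * f i.
  exists (\det M), (fun l i => \sum_l' \adj M l l' * (B i l')%:MP); split.
    rewrite -(det_map_mx (meval q)) -(det1 C m) -det_tr; congr (\det _).
    rewrite -JB; apply/matrixP => l l'; rewrite !mxE raddf_sum /=.
    by apply: eq_bigr => i _; rewrite mevalM mevalC mxE mulrC.
  move=> l; have := cramer_col M (\col_l ('X_l - (q l)%:MP)) l.
  rewrite [X in _ * X = _]mxE => ->.
  under [RHS]eq_bigr do rewrite mulr_suml.
  rewrite [RHS]exchange_big; apply: eq_bigr => l' _.
  under [RHS]eq_bigr do rewrite -mulrA.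
  rewrite -mulr_sumr; congr (_ * _); rewrite mxE.
  under eq_bigr do rewrite [M _ _]mxE [X in _ * X]mxE mulr_suml.
  rewrite exchange_big; apply: eq_bigr => i _.
  by rewrite fE mulr_sumr; apply: eq_bigr => l'' _; rewrite mulrA.
have ring1 : in_local_ring q 1.
  by exists 1, 1; rewrite meval1 oner_eq0 tofrac1 divr1.
exists (fun=> 1) => // z [G [H [Hq ->]]].
(* The class of [G / H] is its value at [q]: [G - d H] vanishes at [q], so it is a combination of
   the [X_l - q_l], and [h] times it is one of the [f i]. *)
pose d := G.@[q] / H.@[q].
exists (const_mx d); split.
  rewrite big_ord1 mulr1 mxE.
  have [a] := hadamard_lemma q (G - d%:MP * H).
  rewrite mevalB mevalM mevalC divfK // subrr mpolyC0 add0r => Ga.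
  exists (fun i => tofrac (\sum_l a l * c l i) / tofrac (h * H)); split.
    move=> i; exists (\sum_l a l * c l i), (h * H); split => //.
    by rewrite mevalM hq mul1r.
  apply: tofrac_divB_sum; [exact: meval_neq0 Hq| |].
    by apply: meval_neq0; rewrite hq oner_eq0.
  under eq_bigr do rewrite mulr_suml.
  rewrite exchange_big /= [in LHS]Ga mulr_sumr; apply: eq_bigr => l _.
  rewrite mulrCA cramer mulr_sumr.
  by apply: eq_bigr => i _; rewrite mulrA.
move=> c'; rewrite big_ord1 mulr1 => /in_local_ideal_vanish[a [b [bq aq zE]]].
apply/rowP => l; rewrite ord1 mxE {l}.
have /(congr1 (meval q)) := tofrac_divB_eq (meval_neq0 Hq) (meval_neq0 bq) zE.
rewrite mevalM [RHS]mevalM aq mul0r mevalB mevalM mevalC => /eqP.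
rewrite mulf_eq0 (negPf bq) orbF subr_eq0 => /eqP Gq.
by rewrite /d Gq mulfK.
Qed.

End LocalRing.

(** The Jacobian in the chart is the full Jacobian at [p] without column [j], so its kernel consists
    of the kernel vectors [z] with [z j = 0]. *)
Lemma dehomogenize_local_multiplicity1 (C : fieldType) (k n : nat)
    (A : tensor C k n) (lam : C) (x : 'rV[C]_n) (j : 'I_n) :
    x 0 j != 0 ->
    let p := fun i => x 0 i / x 0 j in
    (forall i, (eigen_poly A lam i).@[p] = 0) ->
    (forall z, z j = 0 ->
      (forall i, dir_deriv p z (eigen_poly A lam i) = 0) -> forall i, z i = 0) ->
  local_multiplicity A lam x j 1.
Proof.
case: n A x j => [|n] A x j; first by case: j.
move=> xj p Fp ker0; rewrite /local_multiplicity.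
set q := chart_point j x.
have pj : p j = 1 by rewrite /p divff.
pose T : n.+1.-tuple {mpoly C[n]} :=
  [tuple if unlift j i is Some i' then 'X_i' else 1 | i < n.+1].
have Tq i : (tnth T i).@[q] = p i.
  rewrite tnth_mktuple; case: unliftP => [l ->|->]; first by rewrite mevalXU.
  by rewrite meval1 pj.
have aP i : exists b : 'I_n.+1 -> {mpoly C[n.+1]},
    eigen_poly A lam i = 0%:MP + \sum_l b l * ('X_l - (p l)%:MP).
  have [b bE] := hadamard_lemma p (eigen_poly A lam i).
  by exists b; rewrite -(Fp i).
have [a aE] := fin_all_exists aP.
pose g i l := a i (lift j l) \mPo T.
have gE i : dehomogenize j (eigen_poly A lam i) = \sum_l g i l * ('X_l - (q l)%:MP).
  (* Substituting 1 for [X_j] turns [X_j - p_j] into [1 - 1], so the term of index [j] drops out. *)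
  rewrite /dehomogenize -/T aE mpolyC0 add0r raddf_sum /= (bigD1_ord j) //=.
  have TX i' : 'X_i' \mPo T = tnth T i' by rewrite comp_mpolyXU -tnth_nth.
  rewrite (rmorphM (comp_mpoly T)) /= comp_mpolyB comp_mpolyC TX tnth_mktuple unlift_none pj.
  rewrite mpolyC1 subrr mulr0 add0r; apply: eq_bigr => l _.
  by rewrite (rmorphM (comp_mpoly T)) /= comp_mpolyB comp_mpolyC TX tnth_mktuple liftK.
apply: (@local_quotient_dim1 _ _ _ q _ _ g) => // [i|z z0].
  rewrite /dehomogenize -/T comp_mpoly_meval -[RHS](Fp i).
  exact: meval_eq.
pose z' i := if unlift j i is Some l then z l else 0.
have z'l l : z' (lift j l) = z l by rewrite /z' liftK.
have z'j : z' j = 0 by rewrite /z' unlift_none.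
move=> l; rewrite -z'l; apply: (ker0 z' z'j) => i.
rewrite /dir_deriv (bigD1_ord j) //= z'j mulr0 add0r -[RHS](z0 i).
apply: eq_bigr => l' _; rewrite z'l -(hadamard_coef _ (aE i)); congr (_ * _).
by rewrite /g comp_mpoly_meval; apply: meval_eq => i'; rewrite Tq.
Qed.

End LocalAlgebra.

(** * Eigenvalue equations of the adjacency tensor *)

Section EdgeForm.
Import mpoly.

(** Moving the edges to the index set lets vertices serve directly as variable indices. *)
Definition pullback_hypergraph (n : nat) (V : finType) (v : 'I_n -> V)
    (E : hypergraph V) : hypergraph 'I_n :=
  [set e : {set 'I_n} | v @: e \in E].

Section Pullback.
Variables (k n : nat) (V : finType) (v : 'I_n -> V) (E : hypergraph V).
Hypotheses (v_bij : bijective v) (Eunif : hypergraph_uniform k E).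

Lemma pullback_uniform : hypergraph_uniform k (pullback_hypergraph v E).
Proof.
by move=> e; rewrite inE => /Eunif; rewrite card_imset //; apply: bij_inj.
Qed.

Lemma pullback_connected :
  hypergraph_connected E -> hypergraph_connected (pullback_hypergraph v E).
Proof.
case: v_bij => v' vK v'K Econn u w.
have /connectP[s + /(congr1 v')] := Econn (v u) (v w).
rewrite vK => sP ->; elim: s u sP => [|a s IH] u /=; first by rewrite vK.
case/andP => /existsP[e /and3P[eE ue ae]] sP.
apply: (connect_trans (y := v' a)); last by have := IH (v' a); rewrite v'K; apply.
have vE b : (b \in v @^-1: e) = (v b \in e) by rewrite inE.
apply: connect1; apply/existsP; exists (v @^-1: e).
rewrite !vE v'K ue ae !andbT inE.
suff -> : v @: (v @^-1: e) = e by [].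
apply/setP => b; apply/imsetP/idP => [[c ce ->]|be]; first by rewrite -vE.
by exists (v' b); rewrite ?vE v'K.
Qed.

(** The list [i :: t] has length [k], so it fills a set of [k] elements exactly when it stays inside
    and has no repetition. *)
Lemma tuple_set_edge (e : {set 'I_n}) i (t : k.-1.-tuple 'I_n) :
    (0 < k)%N -> #|e| = k -> i \in e ->
  ([set a in i :: t] == e) = all (mem (e :\ i)) t && uniq t.
Proof.
move=> k0 ek ie; apply/idP/andP => [/eqP te|[/allP te tu]].
  have : uniq (i :: t).
    apply/card_uniqP; rewrite /= size_tuple (prednK k0) -[RHS]ek -te.
    by apply: eq_card => a; rewrite inE.
  move=> /= /andP[it ->]; split => //; apply/allP => s st /=.
  rewrite !inE -te inE mem_behead //= andbT.
  by apply: contraNneq it => <-.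
have it : i \notin (t : seq 'I_n) by apply/negP => /te; rewrite !inE eqxx.
rewrite eqEcard; apply/andP; split.
  by apply/subsetP => s; rewrite !inE => /predU1P[->//|/te]; rewrite !inE => /andP[].
rewrite cardsE; have /card_uniqP -> : uniq (i :: t) by rewrite /= it.
by rewrite /= size_tuple prednK // ek.
Qed.

(** For an edge [e] containing [i], the tuples contributing its monomial are the (k-1)! orderings of
    [e :\ i], which cancels the factor 1/(k-1)!. *)
Lemma adjacency_sum (C : numFieldType) (L : comAlgType C) (x : 'I_n -> L) i :
    (0 < k)%N ->
  \sum_(t : k.-1.-tuple 'I_n) adjacency_tensor C k v E i t *: \prod_(s <- t) x s =
  \sum_(e in pullback_hypergraph v E | i \in e) \prod_(s in e :\ i) x s.
Proof.
move=> k0; pose supp (t : k.-1.-tuple 'I_n) := [set a in i :: t].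
have AE t : adjacency_tensor C k v E i t =
    if supp t \in pullback_hypergraph v E then (k.-1)`!%:R^-1 else 0.
  rewrite /adjacency_tensor inE; congr (if _ \in E then _ else _).
  apply/setP => b.
  by apply/imsetP/imsetP => -[a aS ->]; exists a => //; move: aS; rewrite [in _ \in supp t]inE.
rewrite (bigID (fun t => supp t \in pullback_hypergraph v E)) /=.
rewrite [X in _ + X]big1 ?addr0 => [|t /negPf tE]; last by rewrite AE tE scale0r.
rewrite (partition_big supp [pred e in pullback_hypergraph v E | i \in e]) /=; last first.
  by move=> t ->; rewrite !inE eqxx.
apply: eq_bigr => e /andP[eE ie].
have ek := pullback_uniform eE.
rewrite (eq_bigl (fun t => t \in [set t : k.-1.-tuple 'I_n | all (mem (e :\ i)) t & uniq t])); last first.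
  move=> t; rewrite [in RHS]inE -(tuple_set_edge t k0 ek ie) -/(supp t).
  by case: eqP => [->|]; rewrite ?eE ?andbF.
rewrite (eq_bigr (fun=> (k.-1)`!%:R^-1 *: \prod_(s in e :\ i) x s)); last first.
  move=> t; rewrite inE => /andP[/allP te tu].
  rewrite AE; have := tuple_set_edge t k0 ek ie; rewrite tu andbT.
  have -> : all (mem (e :\ i)) t by apply/allP.
  rewrite -/(supp t) => /eqP ->; rewrite eE big_uniq //=; congr (_ *: _).
  apply: eq_bigl => s; have tE : (t : seq 'I_n) =i e :\ i; last by rewrite -tE.
  apply/subset_cardP; last by apply/subsetP => a /te.
  by rewrite (card_uniqP tu) size_tuple; have := ek; rewrite (cardsD1 i e) ie => <-.
rewrite sumr_const card_uniq_tuples.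
have -> : #|mem (e :\ i)| = k.-1 by have := ek; rewrite (cardsD1 i e) ie => <-.
rewrite ffactnn -scaler_nat scalerA mulfV ?scale1r //.
by rewrite pnatr_eq0 -lt0n fact_gt0.
Qed.

End Pullback.

Lemma meval_eigen_poly (C : comNzRingType) (k n : nat) (A : tensor C k n)
    (lam : C) (x : 'rV[C]_n) i :
  (eigen_poly A lam i).@[x 0] = lam * x 0 i ^+ k.-1 - tensor_apply A x 0 i.
Proof.
rewrite /eigen_poly mevalB mevalZ rmorphXn /= mevalXU mxE (raddf_sum (meval _)) /=; congr (_ - _).
apply: eq_bigr => t _; rewrite mevalZ rmorph_prod /=.
by congr (_ * _); apply: eq_bigr => s _; rewrite mevalXU.
Qed.

Lemma in_eigenvarietyP (C : comNzRingType) (k n : nat) (A : tensor C k n)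
    (lam : C) (x : 'rV[C]_n) :
  in_eigenvariety A lam x <->
  x != 0 /\ forall i, (eigen_poly A lam i).@[x 0] = 0.
Proof.
split=> -[x0 xA]; split => //.
  by move=> i; rewrite meval_eigen_poly xA !mxE subrr.
apply/rowP => i; have := xA i; rewrite meval_eigen_poly => /subr0_eq.
by rewrite !mxE.
Qed.

Section AdjacencyPoly.
Variables (C : numFieldType) (k n : nat) (V : finType) (v : 'I_n -> V).
Variables (E : hypergraph V) (lam : C).
Hypotheses (k_gt0 : (0 < k)%N) (v_bij : bijective v).
Hypothesis Eunif : hypergraph_uniform k E.

Let A := adjacency_tensor C k v E.
Let H := pullback_hypergraph v E.

Lemma eigen_poly_adjacency i : eigen_poly A lam i =
  lam *: 'X_i ^+ k.-1 - \sum_(e in H | i \in e) \prod_(s in e :\ i) 'X_s.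
Proof.
by rewrite /eigen_poly (adjacency_sum v_bij Eunif (fun s => 'X_s : {mpoly C[n]})).
Qed.

Lemma mulX_eigen_poly (x : 'I_n -> C) i :
  x i * (eigen_poly A lam i).@[x] = lam * x i ^+ k - star_sum H x i.
Proof.
rewrite eigen_poly_adjacency mevalB mevalZ rmorphXn /= mevalXU mulrBr mulrCA.
rewrite -exprS prednK // raddf_sum /= mulr_sumr; congr (_ - _).
apply: eq_bigr => e /andP[_ ie]; rewrite rmorph_prod /= [in RHS](big_setD1 i) //=.
by congr (_ * _); apply: eq_bigr => s _; rewrite mevalXU.
Qed.

Lemma eigen_polyZ c (x : 'I_n -> C) i :
  (eigen_poly A lam i).@[fun l => c * x l] = c ^+ k.-1 * (eigen_poly A lam i).@[x].
Proof.
rewrite eigen_poly_adjacency !mevalB !mevalZ !rmorphXn /= !mevalXU mulrBr exprMn mulrCA.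
congr (_ - _); rewrite !raddf_sum /= mulr_sumr; apply: eq_bigr => e /andP[eH ie].
rewrite !rmorph_prod /=; under eq_bigr do rewrite mevalXU.
rewrite big_split prodr_const /=.
have -> : #|e :\ i| = k.-1.
  by have := pullback_uniform v_bij Eunif eH; rewrite (cardsD1 i e) ie => <-.
by congr (_ * _); apply: eq_bigr => s _; rewrite mevalXU.
Qed.

Lemma mulX_dir_deriv_eigen_poly (x w : 'I_n -> C) i :
  x i * dir_deriv x (fun s => x s * w s) (eigen_poly A lam i) =
  lam * x i ^+ k * (w i *+ k.-1) -
  \sum_(e in H | i \in e) (\prod_(s in e) x s) * \sum_(s in e :\ i) w s.
Proof.
rewrite eigen_poly_adjacency dir_derivB dir_derivZ dir_deriv_sum mulrBr; congr (_ - _).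
  have -> : 'X_i ^+ k.-1 = \prod_(s < k.-1) 'X_i :> {mpoly C[n]}.
    by rewrite prodr_const card_ord.
  rewrite dir_deriv_prodX prodr_const sumr_const card_ord.
  by rewrite -[in RHS](prednK k_gt0) exprS; ring.
rewrite mulr_sumr; apply: eq_bigr => e /andP[_ ie].
by rewrite dir_deriv_prodX mulrA [in RHS](big_setD1 i).
Qed.

End AdjacencyPoly.

End EdgeForm.

(** * Harmonic functions and extremal eigenvectors *)

(** A Dirichlet energy argument: multiplying equation [i] by the conjugate of [w i] and summing over
    [i] gives half the sum of [c e * |w i - w s| ^ 2] over edges and pairs in them. Hence [w] is
    constant on each edge. *)
Lemma harmonic_const (C : numClosedFieldType) (T : finType) (E : hypergraph T)
    (c : {set T} -> C) (w : T -> C) :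
    hypergraph_connected E -> (forall e, e \in E -> 0 < c e) ->
    (forall i, \sum_(e in E | i \in e) c e * \sum_(s in e) (w i - w s) = 0) ->
  forall u s, w u = w s.
Proof.
move=> Econn c0 harm.
pose D (e : {set T}) := \sum_(i in e) \sum_(s in e) (w i)^* * (w i - w s).
(* Add to [D e] its copy with [i] and [s] exchanged. *)
have D2 e : D e *+ 2 = \sum_(i in e) \sum_(s in e) `|w i - w s| ^+ 2.
  rewrite mulr2n {2}/D exchange_big -big_split; apply: eq_bigr => i _.
  rewrite -big_split; apply: eq_bigr => s _ /=.
  by rewrite normCK rmorphB /=; ring.
have D0 e : 0 <= D e *+ 2.
  by rewrite D2; apply: sumr_ge0 => i _; apply: sumr_ge0 => s _; rewrite exprn_ge0.
have : \sum_(e in E) c e * (D e *+ 2) = 0.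
  rewrite (eq_bigr (fun e => (c e * D e) *+ 2)) => [|e _]; last by rewrite mulrnAr.
  rewrite sumrMnl; apply/eqP; rewrite mulrn_eq0 /=; apply/eqP.
  transitivity (\sum_i (w i)^* *
      \sum_(e in E | i \in e) c e * \sum_(s in e) (w i - w s)); last first.
    by apply: big1 => i _; rewrite harm mulr0.
  under [RHS]eq_bigr do rewrite mulr_sumr.
  rewrite [RHS](exchange_big_dep (fun e => e \in E)) /=; last by move=> i e _ /andP[].
  apply: eq_bigr => e eE; rewrite /D mulr_sumr.
  rewrite [RHS](eq_bigl (fun i => i \in e)) => [|i]; last by rewrite eE.
  by apply: eq_bigr => i _; rewrite -mulr_sumr mulrCA.
move/psumr_eq0P => cD; apply: (connected_const Econn) => e u s eE ue se.
have : D e *+ 2 = 0.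
  have /eqP := cD (fun e eE => mulr_ge0 (ltW (c0 e eE)) (D0 e)) e eE.
  by rewrite mulf_eq0 gt_eqF ?c0 // => /eqP.
rewrite D2 => /psumr_eq0P D2u.
have /psumr_eq0P/(_ s se)/eqP : \sum_(s in e) `|w u - w s| ^+ 2 = 0.
  by apply: D2u => // i _; apply: sumr_ge0 => a _; rewrite exprn_ge0.
by rewrite expf_eq0 /= normr_eq0 subr_eq0 => /(_ (fun _ _ => exprn_ge0 _ (normr_ge0 _))) /eqP.
Qed.

Section ExtremalEigenvector.

Variables (R : realType) (k n : nat) (H : hypergraph 'I_n).
Hypotheses (k_gt0 : (0 < k)%N) (Hunif : hypergraph_uniform k H).
Hypothesis Hconn : hypergraph_connected H.
Variables (mu : R) (lam : R[i]) (x : 'I_n -> R[i]).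
Hypothesis mu_ge0 : 0 <= mu.
Hypothesis mu_max : forall z : 'I_n -> R, (forall i, 0 <= z i) ->
  k%:R * edge_sum H z <= mu * \sum_i z i ^+ k.
Hypothesis mu_lam : mu%:C <= `|lam|.
Hypothesis x_eigen : forall i, star_sum H x i = lam * x i ^+ k.
Variable j : 'I_n.
Hypothesis xj : x j != 0.

(* [|x|] is a subsolution for [|lam| >= mu], so summing over the vertices
   forces equality in every triangle inequality. *)
Lemma extremal_eigenvector :
  (forall i, x i != 0) /\
  (forall i, `|star_sum H x i| = \sum_(e in H | i \in e) `|\prod_(s in e) x s|).
Proof.
pose r := complex.Re `|lam|; pose y i := complex.Re `|x i|.
have rE : r%:C = `|lam| by rewrite RRe_real ?normr_real.
have yE i : (y i)%:C = `|x i| by rewrite RRe_real ?normr_real.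
have y0 i : 0 <= y i by rewrite -lecR yE normr_ge0.
have mur : mu <= r by rewrite -lecR rE.
have r0 := le_trans mu_ge0 mur.
(* The maximality bound is weakened from [mu] to [r], the constant for which [y] will attain it. *)
have rmax (z : 'I_n -> R) : (forall i, 0 <= z i) ->
    k%:R * edge_sum H z <= r * \sum_i z i ^+ k.
  move=> z0; apply: le_trans (mu_max z0) _; apply: ler_wpM2r => //.
  by apply: sumr_ge0 => i _; rewrite exprn_ge0.
have starE i : (star_sum H y i)%:C = \sum_(e in H | i \in e) `|\prod_(s in e) x s|.
  rewrite rmorph_sum; apply: eq_bigr => e _; rewrite rmorph_prod normr_prod.
  by apply: eq_bigr => s _.
have powE i : (r * y i ^+ k)%:C = `|star_sum H x i|.
  by rewrite x_eigen normrM normrX -rE -yE rmorphM rmorphXn.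
have sub i : r * y i ^+ k <= star_sum H y i.
  by rewrite -lecR powE starE ler_norm_sum.
(* Each summand is nonnegative by [sub], while [rmax] at [y] makes the total at most 0. *)
have eqs : \sum_i (star_sum H y i - r * y i ^+ k) = 0.
  apply/eqP; rewrite eq_le sumrB (sum_star_sum Hunif) -mulr_sumr subr_le0 rmax //=.
  rewrite -(sum_star_sum Hunif) mulr_sumr -sumrB.
  by apply: sumr_ge0 => i _; rewrite subr_ge0.
have eqi i : star_sum H y i = r * y i ^+ k.
  apply/eqP; rewrite -subr_eq0; apply/eqP.
  by apply: (psumr_eq0P _ eqs) => // l _; rewrite subr_ge0.
split=> i; last by rewrite -powE -eqi starE.
have ymax : k%:R * edge_sum H y = r * \sum_i y i ^+ k.
  rewrite -(sum_star_sum Hunif) mulr_sumr.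
  by apply: eq_bigr => l _; rewrite eqi.
have yj : y j != 0.
  by apply: contraNneq xj => yj; rewrite -normr_eq0 -yE yj.
have := maximizer_gt0 k_gt0 Hunif Hconn r0 rmax y0 ymax yj i.
by rewrite -ltcR yE normr_gt0.
Qed.

(** Equality in the triangle inequality gives all edge monomials at [i] a common phase [t], which
    cancels. Replacing [lam * x i ^+ k] by the star sum then leaves, on each edge, [k - 1] copies of
    [w i] minus the other [w s], which is the harmonic equation with weights [c e]. *)
Lemma extremal_kernel (w : 'I_n -> R[i]) :
    (forall i, lam * x i ^+ k * (w i *+ k.-1) =
      \sum_(e in H | i \in e) (\prod_(s in e) x s) * \sum_(s in e :\ i) w s) ->
  forall u s, w u = w s.
Proof.
have [x_neq0 x_tri] := extremal_eigenvector.
move=> wE; pose c (e : {set 'I_n}) := `|\prod_(s in e) x s|.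
apply: (harmonic_const (c := c)) Hconn _ _ => [e _|i].
  by rewrite normr_gt0; apply/prodf_neq0 => s _.
have [t /eqP t1 tE] := normC_sum_eq (x_tri i).
have t0 : t != 0 by rewrite -normr_eq0 t1 oner_eq0.
have := wE i; rewrite -x_eigen /star_sum mulr_suml => /eqP.
rewrite -subr_eq0 -sumrB => /eqP sum0.
apply: (mulIf t0); rewrite mul0r -[RHS]sum0 mulr_suml.
apply: eq_bigr => e eP; have /andP[eH ie] := eP.
rewrite (tE e eP) -/(c e) mulrAC -mulrBr; congr (_ * _).
rewrite (big_setD1 i) //= subrr add0r sumrB sumr_const.
by have := Hunif eH; rewrite (cardsD1 i e) ie => <-.
Qed.

End ExtremalEigenvector.

(** * The Perron eigenvalue and the conclusion *)

Section Final.
Import mpoly.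

Lemma perron_eigenvalue (R : realType) (k n : nat) (V : finType) (v : 'I_n -> V)
    (E : hypergraph V) (mu : R) (y : 'I_n -> R) :
    (0 < k)%N -> (0 < n)%N -> bijective v -> hypergraph_uniform k E ->
    (forall i, 0 < y i) ->
    (forall i, star_sum (pullback_hypergraph v E) y i = mu * y i ^+ k) ->
  is_eigenvalue (adjacency_tensor R[i] k v E) mu%:C.
Proof.
move=> k0 n0 v_bij Eunif y0 yE.
exists (\row_i (y i)%:C); apply/in_eigenvarietyP; split.
  apply/eqP => /rowP/(_ (Ordinal n0)); rewrite !mxE => /eqP.
  by rewrite fmorph_eq0 gt_eqF.
move=> i; set x := (\row_l _) 0.
have xE l : x l = (y l)%:C by rewrite /x mxE.
have xi : x i != 0 by rewrite xE fmorph_eq0 gt_eqF.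
apply: (mulfI xi); rewrite mulr0 mulX_eigen_poly //.
apply/eqP; rewrite subr_eq0 xE -rmorphXn -rmorphM -yE rmorph_sum; apply/eqP.
apply: eq_bigr => e _; rewrite rmorph_prod.
by apply: eq_bigr => s _; rewrite xE.
Qed.

Lemma adjacency_multiplicity1 (R : realType) (k n : nat) (V : finType)
    (v : 'I_n -> V) (E : hypergraph V) (lam rho : R[i]) :
  (0 < k)%N -> bijective v -> hypergraph_uniform k E ->
  hypergraph_connected E ->
  let A := adjacency_tensor R[i] k v E in
  is_spectral_radius A rho -> `|lam| = rho ->
  forall (p : 'rV[R[i]]_n), in_eigenvariety A lam p ->
  forall j : 'I_n, p 0 j != 0 -> local_multiplicity A lam p j 1.
Proof.
move=> k0 v_bij Eunif Econn A [_ rho_max] lam_rho p /in_eigenvarietyP[_ pA] j pj.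
have n0 : (0 < n)%N by apply: leq_trans (ltn_ord j).
pose H := pullback_hypergraph v E.
have Hunif : hypergraph_uniform k H := pullback_uniform v_bij Eunif.
have Hconn : hypergraph_connected H := pullback_connected v_bij Econn.
have [mu [y [mu0 y0 yE mu_max]]] := perron R n0 k0 Hunif Hconn.
(* The positive maximizer is itself an eigenvector, so the spectral radius bounds [mu]. *)
have mu_lam : mu%:C <= `|lam|.
  have := rho_max _ (perron_eigenvalue k0 n0 v_bij Eunif y0 yE).
  by rewrite lam_rho ger0_norm // lecR.
apply: dehomogenize_local_multiplicity1 => //= [i|z zj zF].
  rewrite (@meval_eq _ _ _ (fun l => (p 0 j)^-1 * p 0 l)) => [|l]; last exact: mulrC.
  by rewrite eigen_polyZ // pA mulr0.
(* This is the representative with [x j = 1]; homogeneity of degree [k - 1] preserves the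
   equations. *)
set x := (fun i => p 0 i / p 0 j) in zF.
have x_eigen i : star_sum H x i = lam * x i ^+ k.
  apply/esym/subr0_eq; rewrite -(mulX_eigen_poly lam k0 v_bij Eunif).
  rewrite (@meval_eq _ _ x (fun l => (p 0 j)^-1 * p 0 l)) => [|l]; last exact: mulrC.
  by rewrite eigen_polyZ // pA !mulr0.
have xj : x j != 0 by rewrite /x divff // oner_eq0.
have [x_neq0 _] := extremal_eigenvector k0 Hunif Hconn mu0 mu_max mu_lam x_eigen xj.
(* No coordinate of [x] vanishes, so every kernel vector has the form [x * w]. Once [w] is constant,
   [z j = 0] forces [z = 0]. *)
pose w i := z i / x i.
have zE i : z i = x i * w i by rewrite /w mulrC divfK.
have w_const : forall u s, w u = w s.
  apply: (extremal_kernel k0 Hunif Hconn mu0 mu_max mu_lam x_eigen xj) => i.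
  apply/subr0_eq; rewrite -(mulX_dir_deriv_eigen_poly lam k0 v_bij Eunif).
  have -> : dir_deriv x (fun s => x s * w s) (eigen_poly A lam i) =
      dir_deriv x z (eigen_poly A lam i).
    by apply: eq_bigr => s _; rewrite zE.
  by rewrite zF mulr0.
by move=> i; rewrite zE (w_const i j) /w zj mul0r mulr0.
Qed.

End Final.

Theorem theorem1p8 (R : realType) (k n : nat) (V : finType) (v : 'I_n -> V)
    (E : hypergraph V) (lam rho : R[i]) :
  (2 <= k)%N -> bijective v -> hypergraph_uniform k E ->
  hypergraph_connected E ->
  let A := adjacency_tensor R[i] k v E in
  is_eigenvalue A lam -> is_spectral_radius A rho -> `|lam| = rho ->
  forall (p : 'rV[R[i]]_n), in_eigenvariety A lam p ->
  forall j : 'I_n, p 0 j != 0 -> local_multiplicity A lam p j 1.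
Proof.
by move=> k2 v_bij Eu Ec A _; apply: adjacency_multiplicity1 => //; apply: ltnW.
Qed.
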